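(* Let $X$ be a second countable locally compact totally disconnected Abelian group. Let $\xi_1,\xi_2,\xi_3$ be independent identically distributed random variables with values in $X$ and a symmetric distribution $\mu$. Let $\alpha$ be a random variable with a Bernoulli distribution taking the values $0$ and $1$ with probability $\frac12$ each, independent of $(\xi_1,\xi_2,\xi_3)$. Then the following are equivalent: (i) the linear forms $2\xi_1$ and $\xi_1+\xi_2+2\alpha\xi_3$ are identically distributed; (ii) there is a compact Corwin subgroup $K$ of $X$ such that either $\mu=m_K$ or $\mu=m_K*E_x$, where $x\in X$ is an element of order $2$.
   Context: A distribution is symmetric if $\mu(B)=\mu(-B)$ for all Borel $B$. A group $K$ is a Corwin group if $\{2x:x\in K\}=K$. $m_K$ is the Haar probability distribution on the compact subgroup $K$, $E_x$ is the point mass at $x$, and $*$ is convolution. *)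

(* Defs.v *)
From HB Require Import structures.
From mathcomp Require Import all_boot all_order all_algebra.
From mathcomp Require Import all_classical all_reals all_analysis.
Set Implicit Arguments. Unset Strict Implicit. Unset Printing Implicit Defensive.
Import Order.TTheory GRing.Theory Num.Theory.
Local Open Scope classical_set_scope.
Local Open Scope ring_scope.

Section BorelType.
Variable X : topologicalZmodType.
Definition borel : Type := X.
HB.instance Definition _ := Choice.on borel.
HB.instance Definition _ := @isPointed.Build borel (0 : X).
Let borel_measC (A : set borel) :
  <<s (@open X) >> A -> <<s (@open X) >> (~` A).
Proof. by move=> h; rewrite -setTD; exact: sigma_algebraCD. Qed.
HB.instance Definition _ := @isMeasurable.Build (sigma_display (@open X))
  borel <<s (@open X) >> (@sigma_algebra0 _ setT (@open X)) borel_measC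
  (@sigma_algebra_bigcup _ setT (@open X)).
End BorelType.

Definition is_subgroup (X : zmodType) (K : set X) : Prop :=
  K 0 /\ (forall x y, K x -> K y -> K (x - y)).

Definition corwin (X : zmodType) (K : set X) : Prop :=
  (fun x => x *+ 2) @` K = K.

Definition order2 (X : zmodType) (x : X) : Prop := x != 0 /\ x *+ 2 = 0.

Definition symmetric_measure (X : topologicalZmodType) (R : realType)
  (mu : set (borel X) -> \bar R) : Prop :=
  forall B : set (borel X), measurable B ->
    mu B = mu ((fun x : X => - x) @` (B : set X)).

(** [m] is the Haar probability distribution m_K of the compact subgroup K,
    regarded as a distribution on X: a probability measure concentrated on K
    which is invariant under translations by elements of K. *)
Definition haar_prob (X : topologicalZmodType) (R : realType) (K : set X)
  (m : probability (borel X) R) : Prop :=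
  m (K : set (borel X)) = 1%E /\
  forall k : X, K k -> forall B : set (borel X), measurable B ->
    m ((fun y : X => y + k) @` (B : set X)) = m B.

Definition convolution (X : topologicalZmodType) (R : realType)
  (mu nu : set (borel X) -> \bar R) (B : set (borel X)) : \bar R :=
  (\int[nu]_(y in [set: borel X])
     \int[mu]_(x in [set: borel X]) (\1_(B : set X) ((x : X) + (y : X)) : R)%:E)%E.

Definition independent4 d (Omega : measurableType d) (R : realType)
  (P : probability Omega R)
  d1 d2 d3 d4 (T1 : measurableType d1) (T2 : measurableType d2)
  (T3 : measurableType d3) (T4 : measurableType d4)
  (f1 : Omega -> T1) (f2 : Omega -> T2) (f3 : Omega -> T3) (f4 : Omega -> T4)
  : Prop :=
  forall (B1 : set T1) (B2 : set T2) (B3 : set T3) (B4 : set T4),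
    measurable B1 -> measurable B2 -> measurable B3 -> measurable B4 ->
    P (f1 @^-1` B1 `&` f2 @^-1` B2 `&` f3 @^-1` B3 `&` f4 @^-1` B4) =
    (P (f1 @^-1` B1) * P (f2 @^-1` B2) * P (f3 @^-1` B3) * P (f4 @^-1` B4))%E.

Definition ident_distr d (Omega : measurableType d) (R : realType)
  (P : probability Omega R) (X : topologicalZmodType) (f g : Omega -> borel X) : Prop :=
  forall B : set (borel X), measurable B -> P (f @^-1` B) = P (g @^-1` B).

Definition has_distr d (Omega : measurableType d) (R : realType)
  (P : probability Omega R) (X : topologicalZmodType) (f : Omega -> borel X)
  (mu : set (borel X) -> \bar R) : Prop :=
  forall B : set (borel X), measurable B -> P (f @^-1` B) = mu B.

(* Main.v *)
Require Import Defs.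
From HB Require Import structures.
From mathcomp Require Import all_boot all_order all_algebra.
From mathcomp Require Import all_classical all_reals all_analysis.
From mathcomp Require Import lra.
Set Implicit Arguments. Unset Strict Implicit.
Import Order.TTheory GRing.Theory Num.Theory.
Local Open Scope classical_set_scope.
Local Open Scope ring_scope.

(* With n(z) = mu(z + V) for an open subgroup V, write sigma and tau for the
   masses that the laws of xi1 + xi2 and 2 xi1 give to cosets of V.  Condition
   (i) says tau = (sigma + sigma * tau) / 2.  Put c = sigma(0), the sum of the
   squares of the coset masses.  Cauchy-Schwarz gives sigma <= c, hence
   tau <= c, while n(x) <= tau(2x) <= c.  Since c is the mu-average of n, n is
   equal to c wherever it is nonzero; likewise tau and sigma equal c wherever tau is
   nonzero, which forces {tau > 0} to be a subgroup and {n > 0} one of its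
   cosets.  Intersecting over a countable base of open subgroups (van Dantzig)
   shows that mu is a translate of the Haar distribution of K = 2 supp mu; a
   translate by x with 2x in K = 2K can be taken to satisfy 2x = 0.  Conversely,
   both forms have a K-invariant distribution concentrated on K, and two such
   distributions agree on the cosets of V, hence everywhere. *)

(** * Separation, clopen sets and compact open subgroups in topological Abelian groups *)

Section OpenSubgroups.
Variable X : topologicalZmodType.
Implicit Types (x y z : X) (A B C D N V W : set X).

Lemma continuous_addr x : continuous (fun y : X => y + x).
Proof.
move=> y; apply: (@continuous_comp _ _ _ (fun y => (y, x)) (fun z : X * X => z.1 + z.2)).
  by apply: cvg_pair => /=; [exact: cvg_id|exact: cvg_cst].
exact: add_continuous.
Qed.

Lemma continuous_double : continuous (fun y : X => y *+ 2).
Proof.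
move=> y; apply: (@continuous_comp _ _ _ (fun y => (y, y)) (fun z : X * X => z.1 + z.2)).
  by apply: cvg_pair => /=; exact: cvg_id.
exact: add_continuous.
Qed.

Lemma open_translate x A : open A -> open [set y | A (y - x)].
Proof.
by move=> oA; apply: (open_comp _ oA) => y _; exact: continuous_addr.
Qed.

Lemma nbhs_translate x A : nbhs 0 A -> nbhs x [set y | A (y - x)].
Proof.
by move=> A0; apply: (@continuous_addr (- x) x); rewrite subrr.
Qed.

Lemma nbhs0_sub N : nbhs 0 N ->
  exists W, [/\ open W, W 0 & forall a b, W a -> W b -> N (a - b)].
Proof.
move=> N0; have := @sub_continuous X (0, 0) N; rewrite /= subrr => /(_ N0).
move=> [[P Q] /= [P0 Q0] PQ].
exists (interior P `&` interior Q); split.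
- by apply: openI; exact: open_interior.
- by split.
- move=> a b [/interior_subset Pa _] [_ /interior_subset Qb].
  by have := PQ (a, b); apply.
Qed.

(** If W - W avoids y - x, then x + W and y + W are disjoint; such a W exists because the complement
    of the closed set {y - x} is a neighbourhood of 0. *)
Lemma closed1_hausdorff : closed [set (0 : X)] -> hausdorff_space X.
Proof.
move=> c0; rewrite open_hausdorff => x y xy.
have N0 : nbhs 0 (~` [set y - x]).
  have -> : ~` [set y - x] = [set z | (~` [set 0]) (z - (y - x))].
    apply/seteqP; split => z /= h k; apply: h; first exact: subr0_eq.
    by rewrite k subrr.
  apply: open_nbhs_nbhs; split.
    by apply: open_translate; exact: closed_openC.
  move=> /= /eqP; rewrite sub0r opprB subr_eq0; exact/negP.
have [W [oW W0 Wsub]] := nbhs0_sub N0.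
exists ([set z | W (z - x)], [set z | W (z - y)]) => /=.
  by rewrite !inE /= !subrr.
split; [exact: open_translate|exact: open_translate|].
apply/eqP/seteqP; split => // z /= [zx zy].
by apply: (Wsub _ _ zx zy); rewrite /= opprB addrC addrA addrNK.
Qed.

Lemma td_hausdorff : totally_disconnected [set: X] -> hausdorff_space X.
Proof.
move=> td; apply: closed1_hausdorff; rewrite -(td 0 Logic.I).
exact/component_closed/closedT.
Qed.

(** If every member of [S] met [A], the traces on [A] would generate a proper filter; a cluster
    point of it in [A] would lie in every member of [S], these being closed, against the separation
    hypothesis. *)
Lemma compact_filter_base (A : set X) (S : set (set X)) :
  compact A -> S !=set0 -> (forall B, S B -> closed B) ->
  (forall B C, S B -> S C -> S (B `&` C)) ->
  (forall x, A x -> exists2 B, S B & ~ B x) ->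
  exists2 B, S B & A `&` B = set0.
Proof.
move=> cA [B0 SB0] Scl SI Ssep; apply: contrapT => nex.
have AB B : S B -> A `&` B !=set0.
  move=> SB; apply/set0P/eqP => AB0; apply: nex; by exists B.
pose F := filter_from S (fun B => A `&` B).
have FF : Filter F.
  apply: filter_from_filter; first by exists B0.
  move=> B C SB SC; exists (B `&` C); first exact: SI.
  by move=> z [Az [Bz Cz]].
have PF : ProperFilter F by apply: filter_from_proper.
have FA : F A by exists B0 => // z [].
have [p [Ap clp]] := cA F PF FA.
have [B SB nBp] := Ssep p Ap; apply: nBp.
apply: (Scl _ SB) => O Op.
by apply: (clp B O) => //; exists B => // z [].
Qed.

(** The difference set A - B is compact, hence closed, and misses 0. If W - W is disjoint from it,
    then A - W and B - W do not meet. *)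
Lemma disjoint_compact_separation A B : hausdorff_space X ->
  compact A -> compact B -> A `&` B = set0 ->
  exists P Q, [/\ open P, open Q, A `<=` P, B `<=` Q & P `&` Q = set0].
Proof.
move=> hX cA cB AB0.
pose D := (fun z : X * X => z.1 - z.2) @` (A `*` B).
have cD : closed D.
  apply: compact_closed => //; apply: continuous_compact; last exact: compact_setX.
  by apply: continuous_subspaceT => z; exact: sub_continuous.
have D0 : nbhs 0 (~` D).
  apply: open_nbhs_nbhs; split; first exact: closed_openC.
  move=> [[a b] /= [Aa Bb] /eqP]; rewrite subr_eq0 => /eqP ab.
  by have : set0 a by rewrite -AB0; split=> //; rewrite ab.
have [W [oW W0 Wsub]] := nbhs0_sub D0.
pose sh (E : set X) := \bigcup_(a in E) [set y | W (a - y)].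
have osh E : open (sh E).
  apply: bigcup_open => a _.
  apply: (@open_comp _ _ (fun y => a - y)) => // y _.
  apply: (@continuous_comp _ _ _ (fun y => (a, y)) (fun z : X * X => z.1 - z.2)).
    by apply: cvg_pair => /=; [exact: cvg_cst|exact: cvg_id].
  exact: sub_continuous.
exists (sh A), (sh B); split => //.
- by move=> a Aa; exists a => //=; rewrite subrr.
- by move=> a Aa; exists a => //=; rewrite subrr.
- apply/seteqP; split => // y [[a Aa /= Way] [b Bb /= Wby]].
  apply: (Wsub _ _ Way Wby); exists (a, b) => //=.
  by rewrite opprB addrA addrNK.
Qed.

(* Inside a compact neighbourhood the quasicomponent of 0 is connected, hence
   reduced to 0. *)
Lemma clopen_compact_base N : totally_disconnected [set: X] ->
  locally_compact [set: X] -> nbhs 0 N ->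
  exists D, [/\ open D, compact D, D 0 & D `<=` N].
Proof.
move=> td lc N0; have hX := td_hausdorff td.
have [C CT [cC clC]] := lc 0 Logic.I.
have C0 : nbhs 0 C by move: CT; rewrite /within/=; apply: filterS => z; apply.
(* [S] consists of the relatively clopen subsets of [C] that contain 0, so [Q] below is the
   quasicomponent of 0 in [C]. *)
pose S : set (set X) := [set B | [/\ B `<=` C, B 0, closed B & closed (C `\` B)]].
have SC : S C.
  by split=> //; [exact: nbhs_singleton|rewrite setDv; exact: closed0].
have SI B B' : S B -> S B' -> S (B `&` B').
  move=> [BC B0 clB clB'] [B'C B'0 clB1 clB1']; split.
  - by move=> z [/BC].
  - by [].
  - exact: closedI.
  - by rewrite setDIr; exact: closedU.
have Scl B : S B -> closed B by case.
pose Q := [set x | forall B, S B -> B x].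
have QC : Q `<=` C by move=> x /(_ _ SC).
have clQ : closed Q.
  have -> : Q = \bigcap_(B in S) B by [].
  by apply: closed_bigI.
have Q0 : Q 0 by move=> B [].
have Qconn : connected Q.
  apply/connectedP => E [E0 QE sepE].
  wlog E00 : E E0 QE sepE / E false 0.
    move=> wl; have : (E false `|` E true) 0 by rewrite -QE.
    move=> [?|?]; first exact: (wl E).
    apply: (wl (fun b => E (~~ b))) => //=; first by rewrite setUC.
    by rewrite separatedC.
  have [sE1 sE2] := sepE.
  have Ecl b : closed (E b).
    rewrite closure_id eqEsubset; split; first exact: subset_closure.
    move=> z Ez; have Qz : Q z.
      move/closure_id : clQ => ->; apply: closureS Ez.
      by rewrite QE => t; case: b => ?; [right|left].
    move: Qz; rewrite QE; case: b Ez => Ez [] Ez' //.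
      by have : set0 z by rewrite -sE2.
    by have : set0 z by rewrite -sE1.
  have EC b : E b `<=` C.
    apply: (subset_trans _ QC); rewrite QE => t; case: b => ?; [by right|by left].
  have cE b : compact (E b) by apply: (subclosed_compact (Ecl b) cC).
  have E12 : E false `&` E true = set0 by exact: separated_disjoint.
  have [P [P' [oP oP' EP EP' PP']]] := disjoint_compact_separation hX (cE false) (cE true) E12.
  have cD : compact (C `\` (P `|` P')).
    apply: (subclosed_compact _ cC) => //.
    apply: closedI => //; apply: open_closedC; exact: openU.
  have [|B SB CB0] := @compact_filter_base _ S cD (ex_intro _ _ SC) Scl SI.
    move=> x [Cx nPx]; apply: contrapT => nB; apply: nPx.
    have : Q x by move=> B SB; apply: contrapT => nBx; apply: nB; exists B.
    by rewrite QE => -[/EP|/EP']; [left|right].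
  have [BC B0 clB clB'] := SB.
  have BPP : B `<=` P `|` P'.
    move=> z Bz; apply: contrapT => nz; have : set0 z by rewrite -CB0; split; [split=> //; exact: BC|].
    by [].
  (* Cutting [B] down to [P] gives another member of [S], so [Q] lies in [P] and cannot reach the
     part [E true] inside [P']. *)
  have SBP : S (B `&` P).
    have PE : B `&` P = B `&` ~` P'.
      apply/seteqP; split => z [Bz Pz]; split=> //.
        by move=> P'z; have : set0 z by rewrite -PP'.
      by have [] := BPP _ Bz.
    split.
    - by move=> z [/BC].
    - by split => //; exact: EP.
    - by rewrite PE; apply: closedI => //; exact: open_closedC.
    - rewrite setDIr; apply: closedU => //; apply: closedI => //.
      exact: open_closedC.
  have [t Et] := E0 true.
  have Qt : Q t by rewrite QE; right.
  have [_ Pt] := Qt _ SBP.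
  by have : set0 t by rewrite -PP'; split=> //; exact: EP'.
have Q1 x : Q x -> x = 0.
  move=> Qx; have : connected_component [set: X] 0 x by exists Q.
  by rewrite td.
pose NC := interior N `&` interior C.
have oNC : open NC by apply: openI; exact: open_interior.
have cA : compact (C `\` NC).
  apply: (subclosed_compact _ cC) => //.
  by apply: closedI => //; exact: open_closedC.
have [|B SB AB0] := @compact_filter_base _ S cA (ex_intro _ _ SC) Scl SI.
  move=> x [Cx nx]; apply: contrapT => nB; apply: nx.
  suff -> : x = 0 by split; [exact: N0|exact: C0].
  by apply: Q1 => B SB; apply: contrapT => nBx; apply: nB; exists B.
have [BC B0 clB clB'] := SB.
have BNC : B `<=` NC.
  move=> z Bz; apply: contrapT => nz.
  by have : set0 z by rewrite -AB0; split=> //; split=> //; exact: BC.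
exists B; split => //; last by move=> z /BNC [/interior_subset].
  (* Lying in the interior of [C] makes [B] open in the whole group. *)
  have -> : B = NC `&` ~` (C `\` B).
    apply/seteqP; split => z.
      by move=> Bz; split; [exact: BNC|case].
    move=> [[_ /interior_subset Cz] nz]; apply: contrapT => nB; exact: nz.
  by apply: openI => //; exact: closed_openC.
exact: (subclosed_compact clB cC).
Qed.

Definition open_subgroup (V : set X) := is_subgroup V /\ open V.

Lemma subgroup0 V : is_subgroup V -> V 0. Proof. by case. Qed.

Lemma subgroupB V x y : is_subgroup V -> V x -> V y -> V (x - y).
Proof. by case=> _; apply. Qed.

Lemma subgroupN V x : is_subgroup V -> V x -> V (- x).
Proof. by move=> sV Vx; rewrite -sub0r; apply: subgroupB => //; exact: subgroup0. Qed.

Lemma subgroupD V x y : is_subgroup V -> V x -> V y -> V (x + y).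
Proof. by move=> sV Vx Vy; rewrite -[y]opprK; apply: subgroupB => //; exact: subgroupN. Qed.

Lemma nbhs_subgroup_open V : is_subgroup V -> nbhs 0 V -> open V.
Proof.
move=> sV V0; rewrite openE => x Vx; rewrite /interior.
apply: filterS (nbhs_translate x V0) => y /= Vyx.
by rewrite -(subrK x y); exact: subgroupD.
Qed.

(* van Dantzig: take the stabilizer of a compact open neighbourhood. *)
Lemma compact_open_subgroup_base N : totally_disconnected [set: X] ->
  locally_compact [set: X] -> nbhs 0 N ->
  exists V, [/\ open_subgroup V, compact V & V `<=` N].
Proof.
move=> td lc N0; have hX := td_hausdorff td.
have [D [oD cD D0 DN]] := clopen_compact_base td lc N0.
pose H := [set x : X | (forall d, D d -> D (d + x)) /\ (forall d, D d -> D (d - x))].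
have sH : is_subgroup H.
  split; first by split=> d; rewrite (subr0, addr0).
  move=> x y [Dx Dx'] [Dy Dy']; split=> d Dd; first by rewrite addrA; exact/Dy'/Dx.
  by rewrite opprB addrA; exact/Dx'/Dy.
(* Tube argument: [d + w] stays in [D] for [w] near 0, uniformly over the compact set [D]. *)
have H1 : \forall w \near (0 : X), D `<=` [set d | D (d + w)].
  move/compact_near_coveringP : cD => /(_ X (nbhs 0) (fun w d => D (d + w))); apply.
  move=> d Dd; have := @add_continuous X (d, 0) D; rewrite /= addr0; apply.
  by apply: open_nbhs_nbhs.
have H2 : \forall w \near (0 : X), D `<=` [set d | D (d - w)].
  move/compact_near_coveringP : cD => /(_ X (nbhs 0) (fun w d => D (d - w))); apply.
  move=> d Dd; have := @sub_continuous X (d, 0) D; rewrite /= subr0; apply.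
  by apply: open_nbhs_nbhs.
have HD : H `<=` D by move=> x [/(_ 0 D0)]; rewrite add0r.
have oH : open H.
  apply: nbhs_subgroup_open => //; apply: filterS2 H1 H2 => w h1 h2.
  by split=> d Dd; [exact: h1|exact: h2].
exists H; split => //; last exact: subset_trans DN.
apply: (subclosed_compact _ cD) => //.
(* The complement of a subgroup is a union of cosets, so the open subgroup [H] is closed and
   inherits compactness from [D]. *)
have -> : H = ~` \bigcup_(z in ~` H) [set y | H (y - z)].
  apply/seteqP; split => x.
    move=> Hx [z nHz] /= Hxz; apply: nHz.
    by rewrite -[z](subKr x); exact: subgroupB.
  move=> nx; apply: contrapT => nHx; apply: nx; exists x => //=.
  by rewrite subrr; exact: subgroup0.
apply: open_closedC; apply: bigcup_open => z _; exact: open_translate.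
Qed.

End OpenSubgroups.

(** * Countable bases of open subgroups and dense sequences *)

Section CountableBase.
Variable X : topologicalZmodType.

Definition subgroup_base (U : nat -> set X) :=
  (forall n, open_subgroup (U n)) /\
  forall N, nbhs (0 : X) N -> exists n, U n `<=` N.

Definition dense_seq (e : nat -> X) :=
  forall O : set X, open O -> O !=set0 -> exists i, O (e i).

Lemma open_subgroupT : open_subgroup [set: X].
Proof. by split; [split|exact: openT]. Qed.

(** The base sets are numbered by an injection, and each one containing 0 is shrunk to an open
    subgroup; all other indices receive the whole group. *)
Lemma second_countable_subgroup_base : @second_countable X ->
  locally_compact [set: X] -> totally_disconnected [set: X] ->
  exists U, subgroup_base U.
Proof.
move=> [B cB [Bo Bb]] lc td.
have /countable_injP[f finj] := cB.
have /choice[U HU] n : exists V, open_subgroup V /\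
    forall b, B b -> f b = n -> b 0 -> V `<=` b.
  have [[b [Bb0 [fbn b0]]]|nb] := pselect (exists b, B b /\ f b = n /\ b 0).
    have [|V [oV _ Vb]] := @compact_open_subgroup_base X b td lc.
      by apply: open_nbhs_nbhs; split => //; exact: Bo.
    exists V; split => // b' Bb' fb' _.
    suff -> : b' = b by [].
    by apply: finj; rewrite ?inE// fb'.
  exists setT; split; first exact: open_subgroupT.
  by move=> b ? ? ?; exfalso; apply: nb; exists b.
exists U; split; first by move=> n; have [] := HU n.
move=> N N0; have [b [Bb' b0] bN] := Bb 0 N N0.
exists (f b); apply: subset_trans bN.
by have [_] := HU (f b); apply.
Qed.

Lemma second_countable_dense_seq : @second_countable X ->
  exists e, dense_seq e.
Proof.
move=> [B cB [Bo Bb]].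
have /countable_injP[f finj] := cB.
have /choice[e He] n : exists x, forall b, B b -> f b = n -> b !=set0 -> b x.
  have [[b [Bb0 [fbn [x bx]]]]|nb] := pselect (exists b, B b /\ f b = n /\ b !=set0).
    exists x => b' Bb' fb' _.
    suff -> : b' = b by [].
    by apply: finj; rewrite ?inE// fb'.
  by exists 0 => b ? ? ?; exfalso; apply: nb; exists b.
exists e => O oO [x Ox].
have [b [Bb' bx] bO] := Bb x O (open_nbhs_nbhs (conj oO Ox)).
by exists (f b); apply: bO; apply: He => //; exists x.
Qed.

End CountableBase.

(** * Cosets of open subgroups as generators of the Borel sigma-algebra *)

Definition coset {X : topologicalZmodType} (V : set X) (z : X) : set (borel X) :=
  [set x | V ((x : X) - z)].

Section Cosets.
Variable X : topologicalZmodType.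
Implicit Types (V W : set X) (x y z : X).

Lemma coset_refl V x : is_subgroup V -> coset V x x.
Proof. by move=> sV; rewrite /coset/= subrr; exact: subgroup0. Qed.

Lemma coset_eq V x y : is_subgroup V -> V (x - y) -> coset V x = coset V y.
Proof.
move=> sV Vxy; apply/seteqP; split => z; rewrite /coset/= => Vz.
  by rewrite -(subrK x z) -addrA; exact: subgroupD.
by rewrite -(subrK y z) -addrA; apply: subgroupD => //; rewrite -opprB; exact: subgroupN.
Qed.

Lemma coset_sym V x y : is_subgroup V -> coset V x y -> coset V y x.
Proof. by move=> sV; rewrite /coset/= => h; rewrite -opprB; exact: subgroupN. Qed.

Lemma open_coset V x : open_subgroup V -> open (coset V x : set X).
Proof. by move=> [_ oV]; exact: open_translate. Qed.

Lemma open_measurable_borel (A : set X) : open A -> measurable (A : set (borel X)).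
Proof. exact: sub_sigma_algebra. Qed.

Lemma measurable_coset V x : open_subgroup V -> measurable (coset V x).
Proof. by move=> oV; apply: open_measurable_borel; exact: open_coset. Qed.

Lemma closed_measurable_borel (A : set X) : closed A -> measurable (A : set (borel X)).
Proof.
move=> cA; rewrite -[X in measurable X]setCK; apply: measurableC.
by apply: open_measurable_borel; exact: closed_openC.
Qed.

(* Each piece is empty or a whole coset of [V]. *)
Definition piece (e : nat -> X) V := seqDU (fun i => coset V (e i)).

Lemma piece_sub e V i : piece e V i `<=` coset V (e i).
Proof. exact: subset_seqDU. Qed.

Lemma piece_coset e V i x : is_subgroup V -> piece e V i x ->
  piece e V i = coset V x.
Proof.
move=> sV px; have Vx := piece_sub px.
apply/seteqP; split => [y /piece_sub Vy|y Vy].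
  by rewrite (coset_eq sV Vx).
move: px; rewrite /piece /seqDU => -[_ nx]; split.
  by rewrite -(coset_eq sV Vx).
move=> Vy'; apply: nx; move: Vy'; rewrite -!(bigcup_mkord i (fun k => coset V (e k))) => -[k /= ki Vk].
exists k => //; rewrite /coset/= -(subrK y x) -addrA.
by apply: subgroupD => //; exact: coset_sym.
Qed.

Lemma piece_coset_e e V i x : is_subgroup V -> piece e V i x ->
  piece e V i = coset V (e i).
Proof.
by move=> sV px; rewrite (piece_coset sV px) (coset_eq sV (piece_sub px)).
Qed.

Lemma measurable_piece e V i : open_subgroup V -> measurable (piece e V i).
Proof.
move=> oV; apply: measurableD; first exact: measurable_coset.
by apply: bigsetU_measurable => k _; exact: measurable_coset.
Qed.

Lemma piece_cover e V : open_subgroup V -> dense_seq e ->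
  \bigcup_i piece e V i = setT.
Proof.
move=> oV de; rewrite /piece -seqDU_bigcup_eq; apply/seteqP; split=> // x _.
have [|i Vi] := de _ (open_coset x oV).
  by exists x; apply: coset_refl; case: oV.
by exists i => //; apply: coset_sym => //; case: oV.
Qed.

Lemma trivIset_piece e V : trivIset setT (piece e V).
Proof. exact: trivIset_seqDU. Qed.

(** Countable additivity over the pieces, pulled back along [f]. With a random variable as [f] this
    is conditioning on its coset; the identity, translations and doubling are used as well. *)
Lemma measure_piece_sum e V d (T : measurableType d) (R : realType)
    (m : {measure set T -> \bar R}) (f : T -> borel X) (A : set T) :
  open_subgroup V -> dense_seq e -> measurable A -> measurable_fun setT f ->
  m A = (\sum_(i <oo) m (A `&` f @^-1` piece e V i))%E.
Proof.
move=> oV de mA mf.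
have AE : A = \bigcup_i (A `&` f @^-1` piece e V i).
  by rewrite -setI_bigcupr -preimage_bigcup piece_cover// preimage_setT setIT.
have mAi i : measurable (A `&` f @^-1` piece e V i).
  apply: measurableI => //; rewrite -[X in measurable X]setTI.
  by apply: mf => //; exact: measurable_piece.
rewrite {1}AE measure_semi_bigcup//; last by rewrite -AE.
apply: trivIset_setIl; apply/trivIsetP => i j _ _ ij.
by rewrite -preimage_setI; have /trivIsetP -> := @trivIset_piece e V; rewrite ?preimage_set0.
Qed.

(** The empty set is included so that the system is closed under intersection. *)
Definition coset_system : set (set (borel X)) :=
  [set A | A = set0 \/ exists V z, open_subgroup V /\ A = coset V z].

Lemma open_subgroupI V W : open_subgroup V -> open_subgroup W ->
  open_subgroup (V `&` W).
Proof.
move=> [sV oV] [sW oW]; split; last exact: openI.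
split; first by split; exact: subgroup0.
by move=> x y [? ?] [? ?]; split; exact: subgroupB.
Qed.

Lemma coset_system_setI : setI_closed coset_system.
Proof.
move=> A B [->|[V [a [oV ->]]]]; first by rewrite set0I; left.
move=> [->|[W [b [oW ->]]]]; first by rewrite setI0; left.
have [->|/set0P[x [Vx Wx]]] := eqVneq (coset V a `&` coset W b) set0; first by left.
right; exists (V `&` W), x; split; first exact: open_subgroupI.
by rewrite -(coset_eq oV.1 Vx) -(coset_eq oW.1 Wx).
Qed.

(** An open set is the union of the cosets of [e i] modulo [U n] that it contains, and these are
    countably many. *)
Lemma measurable_coset_system (U : nat -> set X) (e : nat -> X) :
  subgroup_base U -> dense_seq e ->
  @measurable _ (borel X) = <<s coset_system >>.
Proof.
move=> [oU bU] de; apply/seteqP; split; last first.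
  apply: smallest_sub; first exact: sigma_algebra_measurable.
  by move=> A [->//|[V [a [oV ->]]]]; exact: measurable_coset.
apply: smallest_sub; first exact: smallest_sigma_algebra.
move=> A oA.
have -> : A = \bigcup_n \bigcup_i
    (if pselect (coset (U n) (e i) `<=` A) then coset (U n) (e i) else set0).
  apply/seteqP; split => x; last first.
    by move=> [n _ [i _]]; case: pselect => // UA /UA.
  move=> Ax; have N0 : nbhs (0 : X) [set y | A (y + x)].
    apply: (@continuous_addr X x 0); rewrite add0r.
    exact: open_nbhs_nbhs.
  have [n Un] := bU _ N0; have [sU _] := oU n.
  have [|i Ui] := de _ (open_coset x (oU n)); first by exists x; exact: coset_refl.
  exists n => //; exists i => //; case: pselect => [?|[]] /=.
    exact: coset_sym.
  by rewrite (coset_eq sU Ui) => y /Un /=; rewrite subrK.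
have [_ _ sbig] := smallest_sigma_algebra setT coset_system.
apply: (sbig) => n; apply: sbig => i.
apply: sub_sigma_algebra; case: pselect => [?|?] /=; last by left.
by right; exists (U n), (e i); split.
Qed.

Lemma probability_coset_eq (U : nat -> set X) (e : nat -> X) (R : realType)
    (m1 m2 : probability (borel X) R) :
  subgroup_base U -> dense_seq e ->
  (forall V z, open_subgroup V -> m1 (coset V z) = m2 (coset V z)) ->
  forall A, measurable A -> m1 A = m2 A.
Proof.
move=> bU de m12 A mA.
apply: (measure_unique coset_system (fun=> setT)) => //.
- exact: measurable_coset_system bU de.
- exact: coset_system_setI.
- by move=> _; right; exists setT, 0; split => //; exact: open_subgroupT.
- by rewrite bigcup_const.
- by move=> _ [->|[V [z [oV ->]]]]; [rewrite !measure0|exact: m12].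
- by move=> _ /=; rewrite probability_setT ltry.
Qed.

Lemma measurable_fun_coset (U : nat -> set X) (e : nat -> X)
    d (T : measurableType d) (f : T -> borel X) :
  subgroup_base U -> dense_seq e ->
  (forall V z, open_subgroup V -> measurable (f @^-1` coset V z)) ->
  measurable_fun setT f.
Proof.
move=> bU de mf; apply: (measurability coset_system).
  exact: measurable_coset_system bU de.
move=> _ [_ [->|[V [z [oV ->]]]] <-]; rewrite setTI; first by rewrite preimage_set0.
exact: mf.
Qed.

(** On the piece of index [i], [f] is congruent to [e i] modulo [V], which turns a condition on the
    sum into one on [g] alone. *)
Lemma add_coset_piece e V (T : Type) (f g : T -> X) z i : is_subgroup V ->
  [set w | coset V z (f w + g w)] `&` [set w | piece e V i (f w)] =
  [set w | piece e V i (f w)] `&` [set w | coset V (z - e i) (g w)].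
Proof.
move=> sV; rewrite setIC; apply/seteqP; split => w /= [pf].
  have Vf := piece_sub pf; move=> Vz; split => //; rewrite /coset/=.
  have -> : g w - (z - e i) = (f w + g w - z) - (f w - e i).
    apply/eqP; rewrite eq_sym subr_eq opprB addrACA (addrAC (e i)) subrr sub0r.
    by rewrite (addrC (g w)).
  exact: subgroupB.
have Vf := piece_sub pf; move=> Vz; split => //; rewrite /coset/=.
have -> : f w + g w - z = (g w - (z - e i)) + (f w - e i).
  by rewrite opprB addrACA (addrAC (e i)) subrr sub0r (addrC (g w)).
exact: subgroupD.
Qed.

(** The preimage of a coset splits over the countably many pieces that [f] may visit, and on each of
    them the condition separates into one on [f] and one on [g]. *)
Lemma measurable_fun_add (U : nat -> set X) (e : nat -> X)
    d (T : measurableType d) (f g : T -> borel X) :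
  subgroup_base U -> dense_seq e ->
  measurable_fun setT f -> measurable_fun setT g ->
  measurable_fun setT (fun w => (f w : X) + (g w : X) : borel X).
Proof.
move=> bU de mf mg; apply: (measurable_fun_coset bU de) => V z oV.
have -> : (fun w => (f w : X) + (g w : X) : borel X) @^-1` coset V z =
    \bigcup_i ([set w | piece e V i (f w)] `&` [set w | coset V (z - e i) (g w)]).
  under eq_bigcupr do rewrite -(add_coset_piece _ _ _ _ _ oV.1).
  rewrite -setI_bigcupr (_ : \bigcup_i _ = setT) ?setIT//.
  by rewrite -[RHS](preimage_setT f) -(piece_cover oV de) preimage_bigcup.
apply: bigcup_measurable => i _; apply: measurableI.
  by rewrite -[X in measurable X]setTI; apply: mf => //; exact: measurable_piece.
by rewrite -[X in measurable X]setTI; apply: mg => //; exact: measurable_coset.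
Qed.

Lemma continuous_measurable_borel (f : X -> X) : continuous f ->
  measurable_fun setT (f : borel X -> borel X).
Proof.
move=> /continuousP cf; apply: (@measurability _ _ (borel X) (borel X) setT f (@open X)) => //.
move=> _ [A oA <-]; rewrite setTI; apply: open_measurable_borel; exact: cf.
Qed.

End Cosets.

(** * Weighted averages with extended real terms *)

Section WeightedAverages.
Variable R : realType.
Local Open Scope ereal_scope.
Implicit Types (a f p : nat -> \bar R) (c x y : \bar R).

Lemma nneseries_term_le f k : (forall i, 0 <= f i) -> f k <= \sum_(i <oo) f i.
Proof.
move=> f0; rewrite (@nneseriesD1 _ f k)// leeDl//.
by apply: nneseries_ge0 => i _ _; exact: f0.
Qed.

Lemma nneseriesZl_fin f x : x \is a fin_num -> (forall i, 0 <= f i) ->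
  \sum_(i <oo) (x * f i) = x * \sum_(i <oo) f i.
Proof. by move=> /fineK <- f0; rewrite nneseriesZl. Qed.

Lemma double_le x y : x + x <= y + y -> x <= y.
Proof. by rewrite leNgt [_ <= _ in X in _ -> X]leNgt; apply: contra => h; exact: lteD. Qed.

Lemma half_average_le x y c : x <= c -> y <= c -> 0 <= c ->
  (2^-1 : R)%:E * x + (2^-1 : R)%:E * y <= c.
Proof.
move=> xc yc c0; have -> : c = (2^-1 : R)%:E * c + (2^-1 : R)%:E * c.
  by rewrite -ge0_muleDl ?lee_fin// -EFinD (_ : _ + _ = 1)%R ?mul1e//; lra.
by apply: leeD; apply: lee_wpmul2l.
Qed.

Lemma half_average_eq x y c : x \is a fin_num -> y \is a fin_num ->
  x <= c -> y <= c ->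
  (2^-1 : R)%:E * x + (2^-1 : R)%:E * y = c -> x = c.
Proof.
move=> /fineK <- /fineK <-; case: c => [c| |] //.
rewrite -!EFinM -EFinD !lee_fin => xc yc [h]; congr EFin.
by move: xc yc h; set u := fine x; set v := fine y => *; lra.
Qed.

(** Non-negativity of the square of x - y; summed termwise it plays the part of the Cauchy-Schwarz
    inequality. *)
Lemma square_sum_ge x y : x \is a fin_num -> y \is a fin_num ->
  x * y + x * y <= x * x + y * y.
Proof.
move=> /fineK <- /fineK <-; rewrite -!EFinM -!EFinD lee_fin.
set u := fine x; set v := fine y.
have := sqr_ge0 (u - v)%R; rewrite expr2; nra.
Qed.

Variable p : nat -> \bar R.
Hypotheses (p0 : forall i, 0 <= p i) (p1 : \sum_(i <oo) p i = 1).

Lemma weight_fin i : p i \is a fin_num.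
Proof.
rewrite ge0_fin_numE//; apply: (@le_lt_trans _ _ 1); last exact: ltry.
by rewrite -p1; exact: nneseries_term_le.
Qed.

Lemma weighted_average_le a c : c \is a fin_num -> (forall i, 0 <= a i <= c) ->
  \sum_(i <oo) p i * a i <= c.
Proof.
move=> cfin ac.
have -> : c = \sum_(i <oo) c * p i by rewrite nneseriesZl_fin// p1 mule1.
apply: lee_nneseries => [i _ _|i _].
  by apply: mule_ge0 => //; have /andP[] := ac i.
by rewrite muleC; apply: lee_wpmul2r => //; have /andP[] := ac i.
Qed.

Lemma weighted_average_cst a c : c \is a fin_num ->
  (forall i, 0 < p i -> a i = c) -> \sum_(i <oo) p i * a i = c.
Proof.
move=> cfin ac.
transitivity (\sum_(i <oo) c * p i); last by rewrite nneseriesZl_fin// p1 mule1.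
apply: eq_eseriesr => i _; have := p0 i; rewrite le_eqVlt => /predU1P[<-|/ac ->].
  by rewrite mul0e mule0.
by rewrite muleC.
Qed.

(** Maximum principle: the deficits [p i * (c - a i)] are non-negative and sum to 0, so each of them
    vanishes. *)
Lemma weighted_average_max a c k : c \is a fin_num -> (forall i, 0 <= a i <= c) ->
  \sum_(i <oo) p i * a i = c -> 0 < p k -> a k = c.
Proof.
move=> cfin ac sc pk.
have afin i : a i \is a fin_num.
  have /andP[a0 aic] := ac i; rewrite ge0_fin_numE//.
  by apply: le_lt_trans aic _; rewrite ltey_eq cfin.
have d0 i : 0 <= p i * (c - a i).
  by apply: mule_ge0 => //; rewrite subre_ge0//; have /andP[] := ac i.
have : \sum_(i <oo) p i * a i + \sum_(i <oo) p i * (c - a i) = c.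
  rewrite -nneseriesD//; last by move=> i _ _; apply: mule_ge0 => //; have /andP[] := ac i.
  rewrite -[RHS](@weighted_average_cst (fun=> c))//.
  apply: eq_eseriesr => i _; rewrite -muleDr ?weight_fin//.
    by rewrite addeC subeK.
  rewrite ge0_adde_def ?inE//; have /andP[] := ac i => //.
  by rewrite subre_ge0.
rewrite sc addeC => /(congr1 (fun y => y - c)); rewrite addeK// subee// => s0.
have := @nneseries_term_le (fun i => p i * (c - a i)) k d0; rewrite s0 => le0.
have /andP[_ akc] := ac k.
apply/eqP; rewrite eq_le akc/= leNgt; apply/negP => lt.
have : 0 < p k * (c - a k) by apply: mule_gt0 => //; rewrite sube_gt0.
by rewrite ltNge le0.
Qed.

End WeightedAverages.

(** * Masses of the cosets of one open subgroup, and the extremal argument *)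

Section CosetMass.
Local Open Scope ereal_scope.
Variables (X : topologicalZmodType) (R : realType) (mu : probability (borel X) R).
Variables (e : nat -> X) (de : dense_seq e).
Implicit Types (V : set X) (x y z : X).

(** The law of twice a [mu]-distributed variable, on cosets: the tau of the opening sketch, whose
    sigma is [sum_mass]. *)
Definition double_mass V z : \bar R :=
  mu [set x : borel X | coset V z ((x : X) *+ 2)%R].

(* The laws of xi1 + xi2 and xi1 + xi2 + 2 alpha xi3 on cosets of V, obtained
   by conditioning on the piece containing xi1, respectively xi3. *)
Definition sum_mass V z : \bar R :=
  \sum_(i <oo) mu (piece e V i) * mu (coset V (z - e i)%R).

Definition form_mass V z : \bar R :=
  (2^-1 : R)%:E * sum_mass V z +
  (2^-1 : R)%:E * \sum_(j <oo) mu (piece e V j) * sum_mass V (z - e j *+ 2)%R.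

Variables (V : set X) (oV : open_subgroup V).
Let sV : is_subgroup V := oV.1.
Let n z := mu (coset V z).
Let p i := mu (piece e V i).


Lemma coset_mass_eq x y : V (x - y)%R -> n x = n y.
Proof. by move=> Vxy; rewrite /n (coset_eq sV Vxy). Qed.

Lemma piece_mass_ge0 i : 0 <= p i. Proof. exact: measure_ge0. Qed.

Lemma piece_mass_sum : \sum_(i <oo) p i = 1.
Proof.
rewrite -(@probability_setT _ _ _ mu).
rewrite [RHS](measure_piece_sum mu oV de measurableT (@measurable_id _ _ setT)).
by apply: eq_eseriesr => i _; rewrite setTI.
Qed.

Lemma piece_mass_coset i x : piece e V i x -> p i = n x.
Proof. by move=> px; rewrite /p (piece_coset sV px). Qed.

Lemma piece_mass_gt0 i : 0 < p i -> p i = n (e i).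
Proof.
move=> pi0; have [pE|/set0P[x px]] := eqVneq (piece e V i) set0.
  by move: pi0; rewrite /p pE measure0 ltxx.
by rewrite /p (piece_coset_e sV px).
Qed.

Lemma piece_mass_exists x : exists i, p i = n x /\ V (x - e i)%R.
Proof.
have : (\bigcup_i piece e V i) x by rewrite (piece_cover oV de).
move=> [i _ px]; exists i; split; first exact: piece_mass_coset.
exact: piece_sub px.
Qed.

Lemma measurable_double_coset z :
  measurable [set x : borel X | coset V z ((x : X) *+ 2)%R].
Proof.
have := continuous_measurable_borel (@continuous_double X).
move=> /(_ measurableT _ (measurable_coset z oV)); rewrite setTI; exact.
Qed.


Lemma sum_mass_ge0 z : 0 <= sum_mass V z.
Proof. by apply: nneseries_ge0 => i _ _; apply: mule_ge0. Qed.

Lemma sum_mass_fin z : sum_mass V z \is a fin_num.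
Proof.
rewrite ge0_fin_numE ?sum_mass_ge0//; apply: (@le_lt_trans _ _ 1); last exact: ltry.
apply: (weighted_average_le piece_mass_ge0 piece_mass_sum) => // i.
by rewrite measure_ge0 probability_le1//; exact: measurable_coset.
Qed.

Lemma double_mass_eq x y : V (x - y)%R -> double_mass V x = double_mass V y.
Proof. by move=> Vxy; rewrite /double_mass (coset_eq sV Vxy). Qed.

(** There are only countably many pieces, so one of them shares positive mass with the event that 2x
    lies in [coset V z]. *)
Lemma double_mass_gt0 z : 0 < double_mass V z ->
  exists x, 0 < n x /\ coset V z (x *+ 2)%R.
Proof.
move=> z0; apply: contrapT => nx; move: z0.
rewrite /double_mass (measure_piece_sum mu oV de (measurable_double_coset z) (@measurable_id _ _ setT)).
rewrite eseries0 ?ltxx// => i _ _.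
have [->|/set0P[x [/= x2 px]]] := eqVneq ([set x : borel X | coset V z ((x : X) *+ 2)%R] `&` id @^-1` piece e V i) set0.
  by rewrite measure0.
apply/eqP; rewrite -measure_le0 leNgt; apply/negP => gt0; apply: nx.
exists x; split => //; apply: (lt_le_trans gt0).
rewrite -(piece_mass_coset px); apply: le_measure; rewrite ?inE.
- by apply: measurableI; [exact: measurable_double_coset|exact: measurable_piece].
- exact: measurable_piece.
- by apply: subIset; right.
Qed.

Lemma coset_mass_le_double x : n x <= double_mass V (x *+ 2)%R.
Proof.
apply: le_measure; rewrite ?inE; [exact: measurable_coset|exact: measurable_double_coset|].
move=> y; rewrite /coset/= -mulrnBl => Vyx; rewrite mulr2n; exact: subgroupD.
Qed.

Section Symmetric.
Hypothesis mu_sym : symmetric_measure mu.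

Lemma coset_mass_opp x : n (- x)%R = n x.
Proof.
rewrite /n [RHS]mu_sym; last exact: measurable_coset.
congr (mu _); apply/seteqP; split => y; rewrite /coset/=.
  move=> Vy; exists (- y)%R; last by rewrite opprK.
  by rewrite -opprD; apply: subgroupN => //; rewrite -[x]opprK.
by move=> [t Vt <-]; rewrite -opprD; exact: subgroupN.
Qed.

(* Both sides are P(xi1 - xi2 in V), computed with two enumerations of the
   cosets; shifting is needed for the Cauchy-Schwarz step [sum_mass_le]. *)
Lemma square_mass_shift z :
  \sum_(i <oo) mu [set x : borel X | piece e V i (x + z)%R] *
               mu [set x : borel X | piece e V i (x + z)%R] =
  \sum_(i <oo) p i * p i.
Proof.
pose F i : set (borel X) := [set x | piece e V i (x + z)%R].
have mz : measurable_fun setT ((fun x : X => x + z)%R : borel X -> borel X).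
  by apply: continuous_measurable_borel => x; exact: continuous_addr.
have mF i : measurable (F i).
  by rewrite -[F i]setTI; apply: mz => //; exact: measurable_piece.
have finF i : mu (F i) \is a fin_num by rewrite fin_num_measure.
(* Where [F i] meets the piece of index [j], both are the coset of a common point, so a factor
   [mu (F i)] can be exchanged for [p j]. Since the [F i] also partition the group, summing over [i]
   first then returns [p j]. *)
transitivity (\sum_(i <oo) \sum_(j <oo) p j * mu (F i `&` piece e V j)).
  apply: eq_eseriesr => i _.
  rewrite -/(F i) [X in _ * X = _](measure_piece_sum mu oV de (mF i) (@measurable_id _ _ setT)).
  rewrite -nneseriesZl_fin//; apply: eq_eseriesr => j _.
  rewrite preimage_id.
  have [->|/set0P[x [/= Fx px]]] := eqVneq (F i `&` piece e V j) set0.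
    by rewrite !measure0 !mule0.
  congr (_ * _); rewrite (piece_mass_coset px) /n; congr (mu _).
  apply/seteqP; split => y; rewrite /F /coset/=.
    move=> py; have := piece_coset sV Fx; rewrite /coset => pE.
    by move: py; rewrite pE/= opprD addrACA subrr addr0.
  by move=> Vy; rewrite (piece_coset sV Fx) /coset/= opprD addrACA subrr addr0.
rewrite nneseries_interchange; last by move=> i j; exact: mule_ge0.
apply: eq_eseriesr => j _.
have pj : p j \is a fin_num by rewrite fin_num_measure//; exact: measurable_piece.
rewrite nneseriesZl_fin//; congr (_ * _).
rewrite [RHS](measure_piece_sum mu oV de (measurable_piece e j oV) mz).
by apply: eq_eseriesr => i _; rewrite setIC.
Qed.

(** By symmetry the coset of [- e i] has the mass of the coset of [e i], which is [p i] unless [p i]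
    vanishes. *)
Lemma sum_mass0 : sum_mass V 0%R = \sum_(i <oo) p i * p i.
Proof.
apply: eq_eseriesr => i _; rewrite -/(n _) -/(p i) sub0r coset_mass_opp.
have := piece_mass_ge0 i; rewrite le_eqVlt => /predU1P[<-|/piece_mass_gt0 <-//].
by rewrite !mul0e.
Qed.

(** By symmetry [sum_mass V z] is the sum of [p i * q i], with [q i] the mass of a piece translated
    by [- z]; [p] and [q] have the same sum of squares, and 2pq <= p^2 + q^2 termwise. *)
Lemma sum_mass_le z : sum_mass V z <= sum_mass V 0%R.
Proof.
apply: double_le.
pose q i := mu [set x : borel X | piece e V i (x + z)%R].
have mz : measurable_fun setT ((fun x : X => x + z)%R : borel X -> borel X).
  by apply: continuous_measurable_borel => x; exact: continuous_addr.
have qfin i : q i \is a fin_num.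
  rewrite fin_num_measure// -[X in measurable X]setTI.
  by apply: mz => //; exact: measurable_piece.
have pfin i : p i \is a fin_num by rewrite fin_num_measure//; exact: measurable_piece.
have -> : sum_mass V z = \sum_(i <oo) p i * q i.
  apply: eq_eseriesr => i _; rewrite -/(n _) -/(p i).
  have [pE|/set0P[x px]] := eqVneq (piece e V i) set0.
    by rewrite /p pE measure0 !mul0e.
  congr (_ * _); rewrite -[LHS]coset_mass_opp opprB /n /q (piece_coset_e sV px).
  by congr (mu _); apply/seteqP; split => y; rewrite /coset/= opprB addrA.
rewrite sum_mass0 -[X in _ <= _ + X](square_mass_shift z).
rewrite -!nneseriesD//; try by move=> i _ _; exact: mule_ge0.
apply: lee_nneseries => [i _ _|i _]; last exact: square_sum_ge.
by apply: adde_ge0; exact: mule_ge0.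
Qed.



Hypothesis mass_eq : forall z, double_mass V z = form_mass V z.

Let c := sum_mass V 0%R.

Lemma average_sum_mass_le z :
  \sum_(j <oo) p j * sum_mass V (z - e j *+ 2)%R <= c.
Proof.
apply: (weighted_average_le piece_mass_ge0 piece_mass_sum).
  exact: sum_mass_fin.
by move=> i; rewrite sum_mass_ge0 sum_mass_le.
Qed.

Lemma average_sum_mass_ge0 z :
  0 <= \sum_(j <oo) p j * sum_mass V (z - e j *+ 2)%R.
Proof.
by apply: nneseries_ge0 => i _ _; apply: mule_ge0 => //; exact: sum_mass_ge0.
Qed.

Lemma double_mass_le z : double_mass V z <= c.
Proof.
rewrite mass_eq; apply: half_average_le.
- exact: sum_mass_le.
- exact: average_sum_mass_le.
- exact: sum_mass_ge0.
Qed.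

Lemma coset_mass_le z : n z <= c.
Proof. exact: le_trans (coset_mass_le_double z) (double_mass_le _). Qed.

(** By definition [c] is the [p]-average of the values n(- e i), none of them above [c]; the maximum
    principle and symmetry give n(e i) = c for each piece of positive mass. *)
Lemma coset_mass_const x : 0 < n x -> n x = c.
Proof.
have [i [pi Vi]] := piece_mass_exists x; rewrite -pi => pi0.
rewrite (piece_mass_gt0 pi0) -coset_mass_opp -sub0r.
apply: (@weighted_average_max _ _ piece_mass_ge0 piece_mass_sum
  (fun i => n (0 - e i)%R) c i _ _ erefl pi0).
  exact: sum_mass_fin.
by move=> j; rewrite measure_ge0 coset_mass_le.
Qed.

(** Some [x] with n(x) > 0 has 2x in z + V, so c = n(x) is at most the mass at 2x, which is the mass
    at [z]. *)
Lemma double_mass_const z : 0 < double_mass V z -> double_mass V z = c.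
Proof.
move=> /double_mass_gt0[x [x0 x2]].
apply/eqP; rewrite eq_le double_mass_le/= -(coset_mass_const x0).
by apply: le_trans (coset_mass_le_double x) _; rewrite (double_mass_eq x2).
Qed.

Lemma sum_mass_const z : 0 < double_mass V z -> sum_mass V z = c.
Proof.
move=> /double_mass_const; rewrite mass_eq.
apply: half_average_eq; [exact: sum_mass_fin| |exact: sum_mass_le|exact: average_sum_mass_le].
rewrite ge0_fin_numE ?average_sum_mass_ge0//.
by apply: le_lt_trans (average_sum_mass_le _) _; rewrite ltey_eq sum_mass_fin.
Qed.

(** As [sum_mass V z] is an average of the n(z - e i) and attains their bound [c], all terms of
    positive weight equal [c], in particular the one for the piece of [y]. *)
Lemma coset_mass_gt0_sub z y : 0 < double_mass V z -> 0 < n y -> 0 < n (z - y)%R.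
Proof.
move=> z0 y0; have [i [pi Vi]] := piece_mass_exists y.
have -> : n (z - y)%R = n (z - e i)%R.
  by apply: coset_mass_eq; rewrite opprB addrC addrA subrK -opprB; exact: subgroupN.
rewrite (@weighted_average_max _ _ piece_mass_ge0 piece_mass_sum
  (fun i => n (z - e i)%R) c i).
- by rewrite -(coset_mass_const y0).
- exact: sum_mass_fin.
- by move=> j; rewrite measure_ge0 coset_mass_le.
- exact: sum_mass_const.
- by rewrite pi.
Qed.

(** The half coming from alpha = 0 contains the term n(x) n(y) of [sum_mass V (x + y)]. *)
Lemma double_mass_gt0_add x y : 0 < n x -> 0 < n y -> 0 < double_mass V (x + y)%R.
Proof.
move=> x0 y0; rewrite mass_eq.
apply: (@lt_le_trans _ _ ((2^-1 : R)%:E * sum_mass V (x + y)%R)); last first.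
  by apply: leeDl; apply: mule_ge0; [rewrite lee_fin|exact: average_sum_mass_ge0].
apply: mule_gt0; first by rewrite lte_fin invr_gt0.
have [i [pi Vi]] := piece_mass_exists x.
apply: (@lt_le_trans _ _ (p i * n (x + y - e i)%R)); last first.
  by apply: (@nneseries_term_le _ (fun i => p i * n (x + y - e i)%R)) => j; exact: mule_ge0.
apply: mule_gt0; first by rewrite pi.
by rewrite (@coset_mass_eq _ y)// addrAC addrK.
Qed.

End Symmetric.
End CosetMass.

(** * Laws of the two linear forms on cosets *)

Lemma coset_double_shift (X : topologicalZmodType) (V : set X) (s t u z : X) :
  is_subgroup V -> V (t - u) ->
  V (s + t *+ 2 - z) <-> V (s - (z - u *+ 2)).
Proof.
move=> sV Vtu; have V2 : V ((t - u) *+ 2) by rewrite mulr2n; exact: subgroupD.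
have E : s - (z - u *+ 2) = s + t *+ 2 - z - (t - u) *+ 2.
  rewrite mulrnBl; apply/eqP.
  by rewrite eq_sym subr_eq opprB addrACA (addrAC (u *+ 2)) subrr sub0r.
rewrite E; split => Vs; first exact: subgroupB.
by rewrite -(subrK ((t - u) *+ 2) (_ - z)); exact: subgroupD.
Qed.

Section LinearForms.
Variables (X : topologicalZmodType) (R : realType) (d : measure_display)
  (Omega : measurableType d) (P : probability Omega R)
  (mu : probability (borel X) R)
  (xi1 xi2 xi3 : Omega -> borel X) (alpha : Omega -> nat).
Hypotheses (m1 : measurable_fun setT xi1) (m2 : measurable_fun setT xi2)
  (m3 : measurable_fun setT xi3) (ma : measurable_fun setT alpha)
  (d1 : has_distr P xi1 mu) (d2 : has_distr P xi2 mu) (d3 : has_distr P xi3 mu)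
  (a0 : P (alpha @^-1` [set 0%N]) = (2^-1 : R)%:E)
  (a1 : P (alpha @^-1` [set 1%N]) = (2^-1 : R)%:E)
  (indep : independent4 P xi1 xi2 xi3 alpha).
Variables (U : nat -> set X) (e : nat -> X).
Hypotheses (bU : subgroup_base U) (de : dense_seq e).

Let form w : borel X := (xi1 w : X) + (xi2 w : X) + (xi3 w : X) *+ (2 * alpha w).

Lemma measurable_preimage d' (T : measurableType d') (f : Omega -> T) (B : set T) :
  measurable_fun setT f -> measurable B -> measurable (f @^-1` B).
Proof. by move=> mf mB; rewrite -[X in measurable X]setTI; exact: mf. Qed.

Lemma measurable_fun_muln (f : Omega -> borel X) k : measurable_fun setT f ->
  measurable_fun setT (fun w => (f w : X) *+ k : borel X).
Proof.
move=> mf; elim: k => [|k IH].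
  by under eq_fun do rewrite mulr0n; exact: measurable_cst.
by under eq_fun do rewrite mulrS; exact: (measurable_fun_add bU de).
Qed.

Lemma measurable_fun_form : measurable_fun setT form.
Proof.
apply: (measurable_fun_coset bU de) => V z oV.
have -> : form @^-1` coset V z = \bigcup_k ((alpha @^-1` [set k]) `&`
    ((fun w => (xi1 w : X) + (xi2 w : X) + (xi3 w : X) *+ (2 * k) : borel X) @^-1` coset V z)).
  apply/seteqP; split => w /=; first by exists (alpha w).
  by move=> [k _ [/= <-]].
apply: bigcup_measurable => k _; apply: measurableI.
  exact: measurable_preimage.
apply: measurable_preimage; last exact: measurable_coset.
apply: (measurable_fun_add bU de); last exact: measurable_fun_muln.
exact: (measurable_fun_add bU de).
Qed.

Lemma measurable_fun_double_form :
  measurable_fun setT (fun w => (xi1 w : X) *+ 2 : borel X).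
Proof. exact: measurable_fun_muln. Qed.

Lemma double_form_coset V z : open_subgroup V ->
  P ((fun w => (xi1 w : X) *+ 2 : borel X) @^-1` coset V z) = double_mass mu V z.
Proof.
move=> oV; rewrite /double_mass -d1//; exact: measurable_double_coset.
Qed.

Local Open Scope ereal_scope.

(** Conditioning on the piece of [xi1] replaces the event on the sum by a condition on [xi1] and one
    on [xi2], so independence applies term by term. Keeping [B3] and [B4] free serves both values of
    [alpha]. *)
Lemma sum_form_coset V z (B3 : set (borel X)) (B4 : set nat) :
  open_subgroup V -> measurable B3 ->
  P ([set w | coset V z ((xi1 w : X) + (xi2 w : X))%R] `&` xi3 @^-1` B3 `&` alpha @^-1` B4)
  = mu B3 * P (alpha @^-1` B4) * sum_mass mu e V z.
Proof.
move=> oV mB3.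
have msum : measurable [set w | coset V z ((xi1 w : X) + (xi2 w : X))%R].
  apply: (@measurable_preimage _ (borel X) (fun w => (xi1 w : X) + (xi2 w : X))%R).
    exact: (measurable_fun_add bU de).
  exact: measurable_coset.
have mB := measurable_preimage m3 mB3.
have mA : measurable (alpha @^-1` B4) by exact: measurable_preimage.
rewrite (measure_piece_sum _ oV de _ m1); last first.
  by apply: measurableI => //; apply: measurableI.
rewrite -nneseriesZl_fin; last 2 first.
- by rewrite fin_numM// fin_num_measure.
- by move=> i; apply: mule_ge0.
apply: eq_eseriesr => i _.
have mp := measurable_piece e i oV; have mc := measurable_coset (z - e i)%R oV.
rewrite [RHS]muleC -(d1 mp) -(d2 mc) -(d3 mB3).
rewrite !muleA -indep//; congr (P _).
rewrite setIC !setIA; congr (_ `&` _ `&` _).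
by rewrite setIC; exact: (add_coset_piece _ _ _ _ _ oV.1).
Qed.

Lemma form_coset V z : open_subgroup V ->
  P (form @^-1` coset V z) = form_mass mu e V z.
Proof.
move=> oV; have mE := measurable_preimage measurable_fun_form (measurable_coset z oV).
have mA k : measurable (alpha @^-1` [set k]) by exact: measurable_preimage.
set E := form @^-1` _ in mE *.
have mEk k : measurable (E `&` alpha @^-1` [set k]) by exact: measurableI.
have A01 : alpha @^-1` [set 0%N] `&` alpha @^-1` [set 1%N] = set0.
  by apply/seteqP; split => // w [/= ->].
(* [alpha] may take any natural value; the values other than 0 and 1 form the null event [N]. *)
set N := ~` (alpha @^-1` [set 0%N] `|` alpha @^-1` [set 1%N]).
have mN : measurable N by apply: measurableC; exact: measurableU.
have PN : P N = 0.
  rewrite probability_setC; last exact: measurableU.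
  have -> : P (alpha @^-1` [set 0%N] `|` alpha @^-1` [set 1%N]) =
      P (alpha @^-1` [set 0%N]) + P (alpha @^-1` [set 1%N]) by exact: measureU.
  have h : (2^-1 + 2^-1 = 1 :> R)%R by lra.
  by rewrite a0 a1 -EFinD h subrr.
have mEN : measurable (E `&` N) by exact: measurableI.
have -> : P E = P (E `&` alpha @^-1` [set 0%N]) + P (E `&` alpha @^-1` [set 1%N]).
  rewrite -measureU//; last by rewrite setIACA A01 setI0.
  rewrite -[RHS](@measureU0 _ _ _ P _ (E `&` N)).
  - by rewrite -!setIUr setUv setIT.
  - exact: measurableU.
  - exact: mEN.
  - apply/eqP; rewrite -measure_le0 -PN; apply: le_measure.
    + by rewrite inE.
    + by rewrite inE.
    + exact: subIsetr.
congr (_ + _).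
  have := sum_form_coset z [set 0%N] oV measurableT.
  rewrite probability_setT mul1e a0 => <-; congr (P _); rewrite preimage_setT setIT.
  by apply/seteqP; split => w [/=]; rewrite /E /form /= => + aw; rewrite aw muln0 addr0.
rewrite (measure_piece_sum _ oV de _ m3)// -nneseriesZl_fin; last 2 first.
- by [].
- by move=> j; apply: mule_ge0 => //; exact: sum_mass_ge0.
apply: eq_eseriesr => j _; have mp := measurable_piece e j oV.
rewrite muleA [X in X * _]muleC -a1 -sum_form_coset//; congr (P _).
rewrite setIAC; apply/seteqP; split => w [[]]; rewrite /E /form /coset/= => Vw pw aw.
  do !split => //; apply/(coset_double_shift _ _ oV.1 (piece_sub pw)).
  by move: Vw; rewrite aw muln1.
do !split => //; rewrite aw muln1.
by apply/(coset_double_shift _ _ oV.1 (piece_sub pw)).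
Qed.

End LinearForms.

(** * Translates of distributions and convolution with a point mass *)

Section Pushforward.
Variables (X : topologicalZmodType) (R : realType).

Lemma pushforward_probability d (T : measurableType d) (P : probability T R)
    (f : T -> borel X) : measurable_fun setT f ->
  exists m : probability (borel X) R, forall B, m B = P (f @^-1` B).
Proof.
move=> mf; pose F := mfun_Sub (mem_set mf : f \in mfun).
by exists (distribution P F) => B.
Qed.

Lemma image_addr (k : X) (B : set X) :
  (fun y => y + k) @` B = (fun y => y - k) @^-1` B.
Proof.
apply/seteqP; split => y /=; first by move=> [z Bz <-]; rewrite addrK.
by move=> By; exists (y - k) => //; rewrite subrK.
Qed.

Lemma measurable_addr (k : X) :
  measurable_fun setT ((fun x : X => x + k) : borel X -> borel X).
Proof. by apply: continuous_measurable_borel => x; exact: continuous_addr. Qed.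

Lemma preimage_addr_coset V (k z : X) :
  (fun y : X => y + k) @^-1` coset V z = coset V (z - k).
Proof. by apply/seteqP; split => y; rewrite /coset/= opprB addrA. Qed.

Variables (U : nat -> set X) (e : nat -> X).
Hypotheses (bU : subgroup_base U) (de : dense_seq e).

(** The point mass evaluates the inner integral at [x], where it is the mass of a translate of [B].
    Measurability of addition in both variables makes the inner integral measurable. *)
Lemma convolution_dirac (m : probability (borel X) R) (x : X) (B : set (borel X)) :
  measurable B ->
  convolution m (\d_(x : borel X)) B = m ((fun y : X => y + x) @^-1` B).
Proof.
move=> mB; rewrite /convolution.
have msum : measurable_fun setT
    (fun z : borel X * borel X => (z.1 : X) + (z.2 : X) : borel X).
  by apply: (measurable_fun_add bU de); [exact: measurable_fst|exact: measurable_snd].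
have mpre y : measurable ((fun x : X => x + y) @^-1` B : set (borel X)).
  by rewrite -[X in measurable X]setTI; exact: measurable_addr.
rewrite integral_dirac//.
  rewrite diracT mul1e; have := integral_indic m measurableT (mpre x).
  by rewrite setIT => <-; apply: eq_integral => y _; rewrite !indicE.
apply: (@measurable_fun_fubini_tonelli_G _ _ (borel X) (borel X) R m
  (fun z => (\1_B ((z.1 : X) + (z.2 : X)) : R)%:E)).
  apply/measurable_realfun.measurable_EFinP.
  apply: (@measurableT_comp _ _ _ _ _ _ (\1_B : borel X -> R)) => //.
by move=> z; rewrite lee_fin.
Qed.

Lemma probability_translate_eq (m : probability (borel X) R) (k : X) :
  (forall V z, open_subgroup V -> m (coset V (z + k)) = m (coset V z)) ->
  forall B : set (borel X), measurable B ->
    m ((fun y : X => y + k) @` (B : set X)) = m B.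
Proof.
move=> mk B mB; rewrite image_addr.
have [m' m'E] := pushforward_probability m (measurable_addr (- k)).
rewrite -m'E; apply: (probability_coset_eq bU de) => // V z oV.
by rewrite m'E preimage_addr_coset opprK mk.
Qed.

End Pushforward.

(** * Supports of [mu] and of its image under doubling *)

Section Support.
Local Open Scope ereal_scope.
Variables (X : topologicalZmodType) (R : realType) (mu : probability (borel X) R).
Variables (U : nat -> set X) (e : nat -> X).
Hypotheses (bU : subgroup_base U) (de : dense_seq e).
Implicit Types (V : set X) (x y z : X).

(** The topological support, tested on cosets of open subgroups since these form a base. *)
Definition supp : set X :=
  [set x | forall V, open_subgroup V -> 0 < mu (coset V x)].

(** The support of the law of twice a [mu]-distributed variable; it serves as the group K of
    (ii). *)
Definition double_supp : set X :=
  [set x | forall V, open_subgroup V -> 0 < double_mass mu V x].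

Lemma coset_subset V W x : V `<=` W -> coset V x `<=` coset W x.
Proof. by move=> VW y /VW. Qed.

Lemma supp_closed : closed supp.
Proof.
move=> x cx V oV.
have [y [Sy Vyx]] := cx _ (open_nbhs_nbhs (conj (open_coset x oV) (coset_refl x oV.1))).
by rewrite -(coset_eq oV.1 Vyx); exact: Sy.
Qed.

(** A point outside the support lies in a null coset of some [U n], and the null pieces for all [n]
    together are countably many. *)
Lemma supp_measure : mu supp = 1.
Proof.
have mS : measurable (supp : set (borel X)) by apply: closed_measurable_borel; exact: supp_closed.
suff : mu (~` supp) = 0.
  move=> h; rewrite -[X in mu X]setCK probability_setC; last exact: measurableC.
  by rewrite h sube0.
apply/(negligibleP mu (measurableC mS)).
pose N n i : set (borel X) := if mu (piece e (U n) i) == 0 then piece e (U n) i else set0.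
apply: (@negligibleS _ _ _ mu (\bigcup_n \bigcup_i N n i)); last first.
  apply: negligible_bigcup => n; apply: negligible_bigcup => i; rewrite /N.
  case: eqP => [h|_]; last exact: negligible_set0.
  by apply/negligibleP => //; apply: measurable_piece; exact: bU.1.
move=> x /existsNP[V /not_implyP[oV /negP]]; rewrite -leNgt measure_le0 => /eqP mx0.
have [n UnV] := bU.2 V (open_nbhs_nbhs (conj oV.2 (subgroup0 oV.1))).
have oU := bU.1 n.
have : (\bigcup_i piece e (U n) i) x by rewrite (piece_cover oU de).
move=> [i _ px]; exists n => //; exists i => //.
rewrite /N ifT// -measure_le0 -mx0 (piece_coset oU.1 px).
apply: le_measure; rewrite ?inE; [exact: measurable_coset|exact: measurable_coset|].
exact: coset_subset.
Qed.

Lemma supp_meets (A : set (borel X)) : measurable A -> 0 < mu A ->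
  exists2 x, supp x & A x.
Proof.
have mS : measurable (supp : set (borel X)) by apply: closed_measurable_borel; exact: supp_closed.
move=> mA A0; apply: contrapT => nx; move: A0.
have : mu A <= mu (~` supp).
  apply: le_measure; rewrite ?inE//; first exact: measurableC.
  by move=> x Ax Sx; apply: nx; exists x.
by rewrite probability_setC// supp_measure subee// => /le_lt_trans/[apply]; rewrite ltxx.
Qed.

Hypotheses (mu_sym : symmetric_measure mu)
  (mass_eq : forall V, open_subgroup V -> forall z, double_mass mu V z = form_mass mu e V z).

Lemma supp_opp x : supp x -> supp (- x)%R.
Proof. by move=> Sx V oV; rewrite (coset_mass_opp oV mu_sym); exact: Sx. Qed.

Lemma double_supp_sub z y : double_supp z -> supp y -> supp (z - y)%R.
Proof.
move=> Kz Sy V oV.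
by apply: (coset_mass_gt0_sub de oV mu_sym (mass_eq oV)); [exact: Kz|exact: Sy].
Qed.

Lemma supp_add x y : supp x -> supp y -> double_supp (x + y)%R.
Proof.
move=> Sx Sy V oV.
by apply: (double_mass_gt0_add de oV (mass_eq oV)); [exact: Sx|exact: Sy].
Qed.

Lemma supp_double_supp_add x z : supp x -> double_supp z -> supp (x + z)%R.
Proof. by move=> Sx Kz; rewrite addrC -[x]opprK; apply: double_supp_sub => //; exact: supp_opp. Qed.

Lemma supp_nonempty : supp !=set0.
Proof.
have [|x Sx _] := @supp_meets setT measurableT; last by exists x.
by rewrite probability_setT lte_fin.
Qed.

(** With [s] in the support, x - y is the sum of x - s and -(y - s), both in the support. *)
Lemma double_supp_subgroup : is_subgroup double_supp.
Proof.
have [s Ss] := supp_nonempty; split.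
  by rewrite -(subrr s); apply: supp_add => //; exact: supp_opp.
move=> x y Kx Ky; have -> : (x - y = (x - s) + - (y - s))%R.
  by rewrite opprB addrA subrK.
by apply: supp_add; [|apply: supp_opp]; exact: double_supp_sub.
Qed.

Lemma supp_coset_mass V x y : open_subgroup V -> supp x -> supp y ->
  mu (coset V x) = mu (coset V y).
Proof.
move=> oV Sx Sy; rewrite (coset_mass_const de oV mu_sym (mass_eq oV) (Sx _ oV)).
by rewrite (coset_mass_const de oV mu_sym (mass_eq oV) (Sy _ oV)).
Qed.

(** A coset of positive mass contains a support point, translation by [k] keeps it in the support,
    and cosets of support points have equal mass. Null cosets are handled by translating back by
    [- k]. *)
Lemma coset_mass_translate V z k : open_subgroup V -> double_supp k ->
  mu (coset V (z + k)%R) = mu (coset V z).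
Proof.
move=> oV; have pos z' k' : double_supp k' -> 0 < mu (coset V z') ->
    mu (coset V (z' + k')%R) = mu (coset V z').
  move=> Kk; move=> /(supp_meets (measurable_coset z' oV))[x Sx Vx].
  have Vxk : V ((x + k') - (z' + k'))%R by rewrite opprD addrACA subrr addr0.
  rewrite -(coset_eq oV.1 Vx) -(coset_eq oV.1 Vxk).
  by apply: supp_coset_mass => //; exact: supp_double_supp_add.
move=> Kk; have [/pos ->//|] := ltP 0 (mu (coset V z)).
rewrite measure_le0 => /eqP z0.
have Kk' := subgroupN double_supp_subgroup Kk.
have [/(pos _ _ Kk')|] := ltP 0 (mu (coset V (z + k)%R)); first by rewrite addrK => <-.
by rewrite measure_le0 => /eqP ->.
Qed.

(** * Compactness of the support and the Corwin property *)

Section Compactness.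
Hypothesis hX : hausdorff_space X.
Variable V : set X.
Hypotheses (oV : open_subgroup V) (cV : compact V).

Lemma compact_coset z : compact (coset V z : set X).
Proof.
have -> : coset V z = (fun y => y + z)%R @` V :> set X by rewrite image_addr.
apply: continuous_compact => //; apply: continuous_subspaceT => y.
exact: continuous_addr.
Qed.

(** All pieces of positive mass have the same mass [c], so infinitely many of them would keep every
    tail of a series with sum 1 at least [c]. *)
Lemma finite_mass_pieces : exists N, forall i, (N <= i)%N -> mu (piece e V i) = 0.
Proof.
pose p i := mu (piece e V i).
have p1 := piece_mass_sum mu de oV.
have [s Ss] := supp_nonempty.
have c0 := Ss V oV; set c := mu (coset V s) in c0.
have pc i : 0 < p i -> p i = c.
  move=> pi0; have [x Sx px] := supp_meets (measurable_piece e i oV) pi0.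
  by rewrite /p (piece_coset oV.1 px); exact: supp_coset_mass.
apply: contrapT => nN.
have tail N : c <= \sum_(N <= i <oo) p i.
  have /existsNP[i /not_implyP[Ni pi0]] : ~ forall i, (N <= i)%N -> p i = 0.
    by move=> h; apply: nN; exists N.
  rewrite -(pc i); last by rewrite lt0e measure_ge0 andbT; exact/eqP.
  apply: (@le_trans _ _ (\sum_(N <= j < i.+1) p j)); last first.
    by apply: nneseries_lim_ge.
  by rewrite big_nat_recr//= leeDr// sume_ge0.
have := @nneseries_tail_cvg R p xpredT; rewrite p1 ltry => /(_ isT (fun i _ => measure_ge0 _ _)) h.
have : c <= limn (fun N => \sum_(N <= i <oo) p i).
  apply: lime_ge; first by apply/cvg_ex; exists 0.
  exact: nearW.
by rewrite (cvg_lim _ h)// leNgt c0.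
Qed.

Lemma supp_compact : compact supp.
Proof.
have [N N0] := finite_mass_pieces.
apply: (subclosed_compact supp_closed (B := \big[setU/set0]_(i < N) coset V (e i))).
  by apply: bigsetU_compact => i _; exact: compact_coset.
move=> x Sx; have : (\bigcup_i piece e V i) x by rewrite (piece_cover oV de).
move=> [i _ px]; rewrite -(bigcup_mkord N (fun i => coset V (e i))).
exists i; last exact: piece_sub px.
rewrite /= ltnNge; apply/negP => /N0; rewrite (piece_coset oV.1 px) => h.
by have := Sx _ oV; rewrite h ltxx.
Qed.

(** The image of the compact support is closed, and every neighbourhood of a point of [double_supp]
    contains the double of a support point. *)
Lemma double_suppE : double_supp = (fun x => x *+ 2)%R @` supp.
Proof.
apply/seteqP; split => [z Kz|_ [x Sx <-]]; last by rewrite mulr2n; exact: supp_add.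
have : closed ((fun x => x *+ 2)%R @` supp).
  apply: compact_closed => //; apply: continuous_compact; last exact: supp_compact.
  by apply: continuous_subspaceT; exact: continuous_double.
apply => B Bz.
have B0 : nbhs (0%R : X) [set y | B (y + z)%R].
  by apply: (@continuous_addr X z 0%R); rewrite add0r.
have [n Un] := bU.2 _ B0; have oU := bU.1 n.
have [x Sx /= Vx] := supp_meets (measurable_double_coset oU z) (Kz _ oU).
by exists ((fun y : X => y *+ 2)%R x); split; [exists x|move: Vx => /Un /=; rewrite subrK].
Qed.

Lemma double_supp_compact : compact double_supp.
Proof.
rewrite double_suppE; apply: continuous_compact; last exact: supp_compact.
by apply: continuous_subspaceT; exact: continuous_double.
Qed.

Lemma supp_sub x y : supp x -> supp y -> double_supp (x - y)%R.
Proof. by move=> Sx Sy; apply: supp_add => //; exact: supp_opp. Qed.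

(** For [k] in the group and [s] in the support, k + 2s equals 2x for some support point [x], and
    then x - s is a half of [k] inside the group. *)
Lemma double_supp_corwin : corwin double_supp.
Proof.
have sK := double_supp_subgroup; have [s Ss] := supp_nonempty.
apply/seteqP; split => [_ [k Kk <-]|k Kk]; first by rewrite mulr2n; exact: (subgroupD sK).
have : double_supp (k + s *+ 2)%R.
  by apply: (subgroupD sK) => //; rewrite mulr2n; exact: supp_add.
rewrite {1}double_suppE => -[x Sx x2]; exists (x - s)%R; first exact: supp_sub.
by rewrite mulrnBl x2 addrK.
Qed.

(** By the Corwin property 2s = 2k with [k] in the group, so s - k is a support point killed by
    2. *)
Lemma supp_involution : exists2 x, supp x & (x *+ 2 = 0)%R.
Proof.
have [s Ss] := supp_nonempty.
have : double_supp (s *+ 2)%R by rewrite mulr2n; exact: supp_add.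
rewrite -double_supp_corwin => -[k Kk k2].
exists (s - k)%R; last by rewrite mulrnBl k2 subrr.
by apply: supp_double_supp_add => //; exact: (subgroupN double_supp_subgroup).
Qed.

(** Translating [mu] by a support point [x] with 2x = 0 concentrates it on the group, and
    translating once more by [x] gives [mu] back. The alternatives are x = 0 and x of order 2. *)
Lemma supp_haar : haar_prob double_supp mu \/
  exists (x : X) (mK : probability (borel X) R),
    [/\ order2 x, haar_prob double_supp mK &
      forall B : set (borel X), measurable B ->
        mu B = convolution mK (\d_(x : borel X)) B].
Proof.
have [x Sx x2] := supp_involution.
have xN : (- x = x)%R by apply/eqP; rewrite -subr_eq0 -opprD oppr_eq0 -mulr2n x2.
have mK : measurable (double_supp : set (borel X)).
  by apply: closed_measurable_borel; apply: compact_closed => //; exact: double_supp_compact.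
have mS : measurable (supp : set (borel X)) by apply: closed_measurable_borel; exact: supp_closed.
have [m mE] := pushforward_probability mu (measurable_addr x).
have hm : haar_prob double_supp m.
  split.
    apply/eqP; rewrite eq_le probability_le1//= -supp_measure mE.
    apply: le_measure; rewrite ?inE//.
      by rewrite -[X in measurable X]setTI; exact: measurable_addr.
    by move=> y Sy /=; exact: supp_add.
  move=> k Kk; apply: (probability_translate_eq bU de) => W z oW.
  by rewrite !mE !preimage_addr_coset addrAC (coset_mass_translate _ oW Kk).
have mu_m B : measurable B -> mu B = m ((fun y : X => y + x)%R @^-1` B).
  move=> mB; rewrite mE; congr (mu _); apply/seteqP; split => y /=.
    by rewrite -addrA -mulr2n x2 addr0.
  by rewrite -addrA -mulr2n x2 addr0.
have [x0|x0] := eqVneq x 0%R; [left|right].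
  move: hm => [h1 h2]; have mum B : mu B = m B.
    by rewrite mE; congr (mu _); apply/seteqP; split => y /=; rewrite x0 addr0.
  split; first by rewrite mum.
  by move=> k Kk B mB; rewrite !mum; exact: h2.
exists x, m; split => // B mB.
by rewrite (convolution_dirac bU de)// mu_m.
Qed.

End Compactness.
End Support.

(** * Converse: invariant distributions concentrated on a coset of a Corwin subgroup *)

Lemma subrBB (M : zmodType) (a b c : M) : a - b - (a - c) = - (b - c).
Proof. by rewrite !opprB addrC addrA subrK. Qed.

Section CosetOfHaar.
Local Open Scope ereal_scope.
Variables (X : topologicalZmodType) (R : realType) (mu : probability (borel X) R).
Variables (e : nat -> X) (de : dense_seq e) (K : set X) (x : X).
Hypotheses (sK : is_subgroup K) (cK : corwin K) (mK : measurable (K : set (borel X)))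
  (x2 : (x *+ 2 = 0)%R)
  (Kx : mu ((fun y : X => y + x)%R @` K) = 1)
  (mu_inv : forall k : X, K k -> forall B : set (borel X), measurable B ->
    mu ((fun y : X => y + k)%R @` (B : set X)) = mu B).
Variables (V : set X) (oV : open_subgroup V).
Let sV : is_subgroup V := oV.1.
Implicit Types (y z k : X).

Lemma haar_coset_mass_translate z k : K k ->
  mu (coset V (z + k)%R) = mu (coset V z).
Proof.
move=> Kk; rewrite -(mu_inv Kk (measurable_coset z oV)) image_addr.
by rewrite (preimage_addr_coset V (- k)%R z) opprK.
Qed.

(** As K = 2K, [k] is twice some [h] in [K], and translating [mu] by [h] shifts the doubles by
    [k]. *)
Lemma haar_double_mass_translate z k : K k ->
  double_mass mu V (z + k)%R = double_mass mu V z.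
Proof.
rewrite -{1}cK => -[h Kh <-]; rewrite /double_mass.
rewrite -(mu_inv Kh (measurable_double_coset oV z)) image_addr; congr (mu _).
have E (y : X) : ((y - h) *+ 2 - z = y *+ 2 - (z + h *+ 2))%R.
  by rewrite mulrnBl (opprD z) addrA addrAC.
by apply/seteqP; split => y; rewrite /coset/= E.
Qed.

Lemma haar_coset_mass_gt0 z : 0 < mu (coset V z) ->
  exists2 k, K k & V (z - x - k)%R.
Proof.
move=> z0; apply: contrapT => nk; move: z0.
have mKx : measurable ((fun y : X => y + x)%R @` K : set (borel X)).
  by rewrite image_addr -[X in measurable X]setTI; exact: measurable_addr.
have : mu (coset V z) <= mu (~` ((fun y : X => y + x)%R @` K)).
  apply: le_measure; rewrite ?inE; [exact: measurable_coset|exact: measurableC|].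
  move=> y Vy [k Kk kxy]; apply: nk; exists k => //.
  rewrite -addrA -opprD [(x + k)%R]addrC kxy; exact: coset_sym.
by rewrite probability_setC// Kx subee// => /le_lt_trans/[apply]; rewrite ltxx.
Qed.

(** Modulo [V], [y] differs from [x] by an element of [K], which invariance absorbs. *)
Lemma haar_coset_mass_shift z y : 0 < mu (coset V y) ->
  mu (coset V (z - y)%R) = mu (coset V (z - x)%R).
Proof.
move=> /haar_coset_mass_gt0[k Kk Vk].
rewrite -(haar_coset_mass_translate (z - x)%R (subgroupN sK Kk)).
apply: (coset_mass_eq mu oV); rewrite -[(z - x - k)%R]addrA -opprD.
have -> : (z - y - (z - (x + k)) = - (y - x - k))%R.
  by rewrite subrBB -addrA -opprD.
exact: subgroupN.
Qed.

Lemma haar_sum_mass z : sum_mass mu e V z = mu (coset V (z - x)%R).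
Proof.
apply: (weighted_average_cst (piece_mass_ge0 mu e V) (piece_mass_sum mu de oV)).
  by rewrite fin_num_measure//; exact: measurable_coset.
move=> i pi0; apply: haar_coset_mass_shift.
by rewrite -(piece_mass_gt0 oV pi0).
Qed.

Lemma double_coset_mass_gt0 y : 0 < mu (coset V y) ->
  exists2 k, K k & V (y *+ 2 - k)%R.
Proof.
move=> /haar_coset_mass_gt0[k Kk Vk]; exists (k *+ 2)%R.
  by rewrite mulr2n; exact: subgroupD.
have -> : (y *+ 2 - k *+ 2 = (y - x - k) *+ 2)%R by rewrite !mulrnBl x2 subr0.
by rewrite mulr2n; exact: subgroupD.
Qed.

(** Where cosets have positive mass, doubles fall in K + V; by invariance the shift by twice the
    third variable changes nothing, and both halves coincide. *)
Lemma haar_form_mass z : form_mass mu e V z = mu (coset V (z - x)%R).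
Proof.
have fin : mu (coset V (z - x)%R) \is a fin_num.
  by rewrite fin_num_measure//; exact: measurable_coset.
rewrite /form_mass haar_sum_mass.
rewrite (@weighted_average_cst _ _ (piece_mass_ge0 mu e V) (piece_mass_sum mu de oV)
  (fun j => sum_mass mu e V (z - e j *+ 2)%R) _ fin); last first.
  move=> i pi0; rewrite haar_sum_mass.
  have [|k Kk Vk] := @double_coset_mass_gt0 (e i).
    by rewrite -(piece_mass_gt0 oV pi0).
  rewrite -(haar_coset_mass_translate (z - x)%R (subgroupN sK Kk)).
  apply: (coset_mass_eq mu oV).
  have -> : (z - e i *+ 2 - x - (z - x - k) = - (e i *+ 2 - k))%R.
    by rewrite [(z - _ - x)%R]addrAC subrBB.
  exact: subgroupN.
have h : (2^-1 + 2^-1 = 1 :> R)%R by lra.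
by rewrite -ge0_muleDl ?lee_fin// -EFinD h mul1e.
Qed.

(** The laws of the double and of the translate by [x], written [D] and [N], are each constant on K
    + V and zero off it. *)
Lemma haar_double_mass_eq z : double_mass mu V z = mu (coset V (z - x)%R).
Proof.
pose D y := double_mass mu V y; pose N y := mu (coset V (y - x)%R).
have N_inv y k : K k -> N (y + k)%R = N y.
  by move=> Kk; rewrite /N addrAC (haar_coset_mass_translate _ Kk).
have val0 y : (exists2 k, K k & V (y - k)%R) -> D y = D 0%R /\ N y = N 0%R.
  move=> [k Kk Vyk]; split.
    by rewrite /D (double_mass_eq mu oV Vyk) -[k]add0r haar_double_mass_translate.
  rewrite -[RHS](N_inv 0%R k Kk) add0r; apply: (coset_mass_eq mu oV).
  by rewrite opprB addrA subrK.
have out y : ~ (exists2 k, K k & V (y - k)%R) -> D y = 0 /\ N y = 0.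
  move=> nk; split; apply/eqP; rewrite -measure_le0 leNgt; apply/negP => y0; apply: nk.
    have [t [t0 Vt]] := double_mass_gt0 de oV y0.
    have [k Kk Vk] := double_coset_mass_gt0 t0; exists k => //.
    rewrite -(subrKA (t *+ 2)%R); apply: subgroupD => //; exact: coset_sym.
  have [k Kk Vk] := haar_coset_mass_gt0 y0; exists k => //.
  by move: Vk; rewrite -[(y - x - x)%R]addrA -opprD -mulr2n x2 subr0.
have mD : measurable_fun setT ((fun y : X => y *+ 2)%R : borel X -> borel X).
  exact: continuous_measurable_borel (@continuous_double X).
pose a i := mu ((fun y : X => y *+ 2)%R @^-1` piece e V i).
pose b i := mu ((fun y : X => y + x)%R @^-1` piece e V i).
have a1 : \sum_(i <oo) a i = 1.
  rewrite -(@probability_setT _ _ _ mu) [RHS](measure_piece_sum mu oV de measurableT mD).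
  by apply: eq_eseriesr => i _; rewrite setTI.
have b1 : \sum_(i <oo) b i = 1.
  rewrite -(@probability_setT _ _ _ mu).
  rewrite [RHS](measure_piece_sum mu oV de measurableT (@measurable_addr X x)).
  by apply: eq_eseriesr => i _; rewrite setTI.
(* Since D(0) N(t) = N(0) D(t) for every [t] and both laws have total mass 1, summing over the
   pieces equates the two constants. *)
have DN : D 0%R = N 0%R.
  have Dfin : D 0%R \is a fin_num.
    by rewrite fin_num_measure//; exact: measurable_double_coset.
  have Nfin : N 0%R \is a fin_num.
    by rewrite fin_num_measure//; exact: measurable_coset.
  rewrite -[LHS]mule1 -b1 -[RHS]mule1 -a1 -!nneseriesZl_fin//.
  apply: eq_eseriesr => i _; rewrite /a /b.
  have [->|/set0P[t pt]] := eqVneq (piece e V i) set0.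
    by rewrite !preimage_set0 !measure0 !mule0.
  rewrite (piece_coset sV pt) preimage_addr_coset -/(N t) -[mu (_ @^-1` _)]/(D t).
  have [/val0[-> ->]|/out[-> ->]] := pselect (exists2 k, K k & V (t - k)%R).
    by rewrite muleC.
  by rewrite !mule0.
rewrite -/(D z) -/(N z).
by have [/val0[-> ->]|/out[-> ->]] := pselect (exists2 k, K k & V (z - k)%R).
Qed.

Lemma haar_mass_eq z : double_mass mu V z = form_mass mu e V z.
Proof. by rewrite haar_form_mass haar_double_mass_eq. Qed.

End CosetOfHaar.

(** * Assembly of the two implications from the coset identities *)

Unset Implicit Arguments. Set Strict Implicit.

Theorem theorem3p3
  (X : topologicalZmodType)
  (X_sc : @second_countable X)
  (X_lc : locally_compact [set: X])
  (X_td : totally_disconnected [set: X])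
  (R : realType) (d : measure_display) (Omega : measurableType d)
  (P : probability Omega R)
  (mu : probability (borel X) R) (mu_sym : symmetric_measure mu)
  (xi1 xi2 xi3 : Omega -> borel X) (alpha : Omega -> nat)
  (m1 : measurable_fun setT xi1) (m2 : measurable_fun setT xi2)
  (m3 : measurable_fun setT xi3) (ma : measurable_fun setT alpha)
  (d1 : has_distr P xi1 mu) (d2 : has_distr P xi2 mu) (d3 : has_distr P xi3 mu)
  (a0 : P (alpha @^-1` [set 0%N]) = (2^-1 : R)%:E)
  (a1 : P (alpha @^-1` [set 1%N]) = (2^-1 : R)%:E)
  (indep : independent4 P xi1 xi2 xi3 alpha) :
  ident_distr P (fun w => ((xi1 w : X) *+ 2 : borel X))
     (fun w => ((xi1 w : X) + (xi2 w : X) + (xi3 w : X) *+ (2 * alpha w) : borel X))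
  <->
  exists K : set X,
    [/\ is_subgroup K, compact K, corwin K &
      (haar_prob K mu \/
       exists (x : X) (mK : probability (borel X) R),
         [/\ order2 x, haar_prob K mK &
           forall B : set (borel X), measurable B ->
             mu B = convolution mK (\d_(x : borel X)) B])].
Proof.
have hX := td_hausdorff X_td.
have [U bU] := second_countable_subgroup_base X_sc X_lc X_td.
have [e de] := second_countable_dense_seq X_sc.
have [V [oV cV _]] := compact_open_subgroup_base X_td X_lc filterT.
pose dbl w : borel X := (xi1 w : X) *+ 2.
pose form w : borel X := (xi1 w : X) + (xi2 w : X) + (xi3 w : X) *+ (2 * alpha w).
have mdbl : measurable_fun setT dbl by exact: (measurable_fun_double_form m1 bU de).
have mform : measurable_fun setT form.
  exact: (measurable_fun_form m1 m2 m3 ma bU de).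
have dblE W z : open_subgroup W -> P (dbl @^-1` coset W z) = double_mass mu W z.
  by move=> oW; exact: (double_form_coset d1).
have formE W z : open_subgroup W -> P (form @^-1` coset W z) = form_mass mu e W z.
  by move=> oW; exact: (form_coset m1 m2 m3 ma d1 d2 d3 a0 a1 indep bU de).
split => [i|[K [sK cK corK Kmu]]].
  have mass_eq W : open_subgroup W ->
      forall z, double_mass mu W z = form_mass mu e W z.
    by move=> oW z; rewrite -dblE// -formE//; apply: i; exact: measurable_coset.
  exists (double_supp mu); split.
  - exact: (double_supp_subgroup bU de mu_sym mass_eq).
  - exact: (double_supp_compact bU de mu_sym mass_eq hX oV cV).
  - exact: (double_supp_corwin bU de mu_sym mass_eq hX oV cV).
  - exact: (supp_haar bU de mu_sym mass_eq hX oV cV).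
have mK : measurable (K : set (borel X)).
  by apply: closed_measurable_borel; exact: compact_closed.
(* Both alternatives are treated at once: [mu] is [K]-invariant and concentrated on K + x with 2x =
   0, where x = 0 in the first case. *)
have [x [x2 Kx mu_inv]] : exists x : X, [/\ x *+ 2 = 0,
    mu ((fun y : X => y + x) @` K) = 1%E &
    forall k : X, K k -> forall B : set (borel X), measurable B ->
      mu ((fun y : X => y + k) @` (B : set X)) = mu B].
  case: Kmu => [[K1 Kinv]|[x [m [[_ x2] [K1 Kinv] muE]]]].
    exists 0; split => //; first by rewrite mul0rn.
    rewrite (_ : _ @` K = K)//; apply/seteqP; split => [_ [y Ky <-]|y Ky].
      by rewrite addr0.
    by exists y => //; rewrite addr0.
  have mtr (k : X) (B : set (borel X)) : measurable B ->
      measurable ((fun y : X => y + k) @` (B : set X) : set (borel X)).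
    move=> mB; rewrite image_addr -[X in measurable X]setTI.
    exact: measurable_addr.
  have mu_m (B : set (borel X)) : measurable B ->
      mu B = m ((fun y : X => y + x) @^-1` B).
    by move=> mB; rewrite muE// (convolution_dirac bU de).
  exists x; split => //.
    rewrite mu_m; last exact: mtr.
    rewrite -K1 image_addr; congr (m _).
    by apply/seteqP; split => y /=; rewrite addrK.
  move=> k Kk B mB; rewrite mu_m; last exact: mtr.
  rewrite (mu_m B)// -[RHS](Kinv k Kk); last first.
    by rewrite -[X in measurable X]setTI; exact: measurable_addr.
  rewrite !image_addr; congr (m _).
  by apply/seteqP; split => y /=; rewrite addrAC.
(* The laws of the two forms are Borel probabilities on the group, so comparing them on cosets of
   open subgroups is enough. *)
have [md mdE] := pushforward_probability P mdbl.
have [mf mfE] := pushforward_probability P mform.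
move=> B mB; rewrite -/dbl -/form -mdE -mfE.
apply: (probability_coset_eq bU de) => // W z oW.
rewrite mdE mfE dblE// formE//.
exact: (haar_mass_eq de sK corK mK x2 Kx mu_inv oW).
Qed.
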